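(* Let $\mathcal{M}$ be a realized matroid over $\mathbb{Z}$ on the ground set $[n]$ with $\mathcal{M}(\emptyset)=\mathbb{Z}^{d}$ free. Then $\operatorname{Gr}\mathcal{M}$, with the partial order generated by the covering relation, is a simplicial poset.
   Context: A matroid over $\mathbb{Z}$ on $[n]=\{1,\dots,n\}$ assigns to each $A\subseteq[n]$ a finitely generated abelian group $\mathcal{M}(A)$ (up to isomorphism). It is realized if a list $z_1,\dots,z_n\in\mathcal{M}(\emptyset)$ is fixed with $\mathcal{M}(A)=\mathcal{M}(\emptyset)/(z_i : i\in A)$ for all $A$. Write $\mathcal{M}(A)\cong\mathbb{Z}^{d(A)}\times G_A$ with $G_A$ finite (the torsion subgroup), and $C_A=\operatorname{Hom}(G_A,\mathbb{C}^* )$ its dual group. For $A\subseteq[n]$ and $b\notin A$, the canonical projection $\pi_{(A,b)}:\mathcal{M}(A)\to\mathcal{M}(A\cup\{b\})$ is the quotient map by the image of $z_b$; it sends $G_A$ into $G_{A\cup\{b\}}$, and the dual map $\pi^{(A,b)}:C_{A\cup\{b\}}\to C_A$ is $h\mapsto h\circ\pi_{(A,b)}|_{G_A}$. The set of torsions $\operatorname{Gr}\mathcal{M}$ is the set of pairs $(A,l)$ with $A\subseteq[n]$, $d(\emptyset)-d(A)=\#A$ and $l\in C_A$. For $(A\cup\{b\},h),(A,l)\in\operatorname{Gr}\mathcal{M}$ with $b\notin A$, we say $(A\cup\{b\},h)$ covers $(A,l)$ if $\pi^{(A,b)}(h)=l$; $\operatorname{Gr}\mathcal{M}$ is partially ordered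 by the reflexive–transitive closure of this covering relation. A finite poset with a unique minimal element $\hat 0$ is simplicial if for every element $\sigma$ the interval $[\hat0,\sigma]=\{x:\hat0\le x\le\sigma\}$ is isomorphic to a Boolean lattice. *)

(* Defs.v *)
From HB Require Import structures.
From Stdlib Require Import Relation_Definitions Relation_Operators.
From mathcomp Require Import all_boot all_order all_algebra.
From mathcomp Require Import boolp classical_sets cardinality reals.
From mathcomp Require Import complex.

Set Implicit Arguments.
Unset Strict Implicit.
Unset Printing Implicit Defensive.

Import GRing.Theory.
Local Open Scope ring_scope.
Local Open Scope quotient_scope.

Section Torsion.
Variable Q : zmodType.

Definition torsion : {pred Q} :=
  fun x => `[< exists2 k : nat, (0 < k)%N & x *+ k = 0 >].

Lemma torsionP x :
  reflect (exists2 k : nat, (0 < k)%N & x *+ k = 0) (x \in torsion).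
Proof. exact: asboolP. Qed.

Lemma torsion_zmod_closed : zmod_closed torsion.
Proof.
split=> [|x y /torsionP[k k0 xk] /torsionP[l l0 yl]]; apply/torsionP.
  by exists 1%N; rewrite ?mul0rn.
exists (k * l)%N; first by rewrite muln_gt0 k0.
by rewrite mulrnBl mulrnA xk mul0rn mulnC mulrnA yl mul0rn subr0.
Qed.

HB.instance Definition _ :=
  GRing.isZmodClosed.Build Q torsion torsion_zmod_closed.

Record torsion_group := TorsionGroup {
  torsion_val : Q;
  torsion_valP : torsion_val \in torsion }.

HB.instance Definition _ := [isSub for torsion_val].
HB.instance Definition _ := [Choice of torsion_group by <:].
HB.instance Definition _ := [SubChoice_isSubZmodule of torsion_group by <:].

Definition is_free_rank (r : nat) : Prop :=
  exists f : {additive Q -> ('rV[int]_r * torsion_group)%type}, bijective f.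

(* The value is meaningful only when such a decomposition exists, in particular
   for every finitely generated Q. *)
Definition free_rank : nat := xget 0%N is_free_rank.

End Torsion.

(* Group morphisms from G (additive) to the multiplicative group of nonzero
   complex numbers. *)
Section DualGroup.
Variables (R : realType) (G : zmodType).

Record dual_group := DualGroup {
  dual_fun :> G -> R[i];
  dual_neq0 : forall x, dual_fun x != 0;
  dualD : forall x y, dual_fun (x + y) = dual_fun x * dual_fun y }.

End DualGroup.

Section RealizedMatroid.
Variables (V : zmodType) (n : nat) (z : 'I_n -> V).
Implicit Types (A B : {set 'I_n}) (b : 'I_n).

Definition gen_sub A : {pred V} :=
  fun v => `[< exists c : 'I_n -> int, v = \sum_(i in A) z i *~ c i >].

Lemma gen_subP A v :
  reflect (exists c : 'I_n -> int, v = \sum_(i in A) z i *~ c i)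
          (v \in gen_sub A).
Proof. exact: asboolP. Qed.

Lemma gen_sub_zmod_closed A : zmod_closed (gen_sub A).
Proof.
split=> [|u v /gen_subP[c ->] /gen_subP[e ->]]; apply/gen_subP.
  by exists (fun=> 0); rewrite big1.
exists (fun i => c i - e i); rewrite -sumrB.
by apply: eq_bigr => i _; rewrite mulrzBr.
Qed.

HB.instance Definition _ A :=
  GRing.isZmodClosed.Build V (gen_sub A) (gen_sub_zmod_closed A).

Definition realized A : zmodType := Quotient.quot (gen_sub A).

Definition mk A (v : V) : realized A := \pi_(Quotient.quot (gen_sub A)) v.

Lemma mk_eq A u v : (mk A u = mk A v) <-> (u - v \in gen_sub A).
Proof. by rewrite Quotient.idealrBE; split=> [/eqP|/eqP]. Qed.

Lemma mkB A : {morph mk A : u v / u - v}.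
Proof. exact: raddfB. Qed.

Lemma mk_surj A (x : realized A) : exists v, x = mk A v.
Proof. by exists (repr x); rewrite /mk reprK. Qed.

(* It sends the class of v to the class of v, see proj_mk below. *)
Definition proj A b (x : realized A) : realized (b |: A) :=
  mk (b |: A) (repr x).

Lemma gen_subS A B v : A \subset B -> v \in gen_sub A -> v \in gen_sub B.
Proof.
move=> /fintype.subsetP sAB /gen_subP[c ->].
apply: rpred_sum => i iA; apply/gen_subP; exists (fun j => c j *+ (j == i)).
rewrite (bigD1 i) ?sAB //= eqxx big1 ?addr0 // => j /andP[_ /negPf ->].
by rewrite mulr0n mulr0z.
Qed.

Lemma proj_mk A b v : proj b (mk A v) = mk (b |: A) v.
Proof.
apply/mk_eq; apply: gen_subS (finset.subsetUr _ A) _; apply/mk_eq.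
by rewrite /mk reprK.
Qed.

Lemma projB A b : zmod_morphism (@proj A b).
Proof.
move=> x y; have [u ->] := mk_surj x; have [v ->] := mk_surj y.
by rewrite -mkB !proj_mk mkB.
Qed.

HB.instance Definition _ A b :=
  GRing.isZmodMorphism.Build (realized A) (realized (b |: A))
    (@proj A b) (@projB A b).

Definition tors A : zmodType := torsion_group (realized A).

Lemma proj_torsion A b (x : tors A) :
  proj b (torsion_val x) \in @torsion (realized (b |: A)).
Proof.
have /torsionP[k k0 xk] := torsion_valP x.
by apply/torsionP; exists k => //; rewrite -raddfMn xk raddf0.
Qed.

Definition proj_tors A b (x : tors A) : tors (b |: A) :=
  TorsionGroup (proj_torsion b x).

Lemma proj_torsD A b (x y : tors A) :
  proj_tors b (x + y) = proj_tors b x + proj_tors b y.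
Proof. by apply: val_inj; rewrite /= raddfD. Qed.

Definition rank A : nat := free_rank (realized A).

Section Gr.
Variable R : realType.

Definition dual A : Type := dual_group R (tors A).

Lemma dual_proj_neq0 A b (h : dual (b |: A)) (x : tors A) :
  h (proj_tors b x) != 0.
Proof. exact: dual_neq0. Qed.

Lemma dual_projD A b (h : dual (b |: A)) (x y : tors A) :
  h (proj_tors b (x + y)) = h (proj_tors b x) * h (proj_tors b y).
Proof. by rewrite proj_torsD dualD. Qed.

Definition dual_proj A b (h : dual (b |: A)) : dual A :=
  DualGroup (dual_proj_neq0 h) (dual_projD h).

Record Gr := MkGr {
  gr_set : {set 'I_n};
  gr_char : dual gr_set;
  gr_indep : (rank finset.set0)%:Z - (rank gr_set)%:Z = #|gr_set|%:Z }.

(* Gr_covers p q : p covers q. *)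
Definition Gr_covers (p q : Gr) : Prop :=
  exists A b (h : dual (b |: A)) hA (l : dual A) lA,
    [/\ b \notin A, p = @MkGr (b |: A) h hA, q = @MkGr A l lA
      & dual_proj h = l].

Definition Gr_le : Gr -> Gr -> Prop :=
  clos_refl_trans Gr (fun p q => Gr_covers q p).

End Gr.
End RealizedMatroid.

Arguments Gr_covers {V n} z R p q.
Arguments Gr_le {V n} z R _ _.

Section SimplicialPoset.
Variables (T : Type) (le : T -> T -> Prop).

Definition minimal (m : T) : Prop := forall x, le x m -> x = m.

Definition closed_interval (a b : T) : Type := {x : T | le a x /\ le x b}.

Definition boolean_interval (a b : T) : Prop :=
  exists (k : nat) (f : closed_interval a b -> {set 'I_k}),
    bijective f /\
    forall x y, le (sval x) (sval y) <-> f x \subset f y.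

Definition simplicial_poset : Prop :=
  [/\ finite_set [set: T], Relation_Definitions.order T le
    & exists bot, unique minimal bot /\
        forall s, boolean_interval bot s].

End SimplicialPoset.

(* Main.v *)
(** The Smith normal form of the matrix of the [z i], [i] in [A], splits
    [M(A)] as a free part of rank [d - r(A)] plus its torsion, where [r(A)] is
    the rank over the rationals; so [d(0) - d(A) = #A] means that the [z i] are
    linearly independent, a condition inherited by subsets.  The order then has
    a direct description: [(A, h) <= (B, l)] iff [A] is contained in [B] and
    [h] is the restriction of [l] along [G_A -> G_B].  Hence an element below
    [(B, l)] is determined by its underlying set, every subset of [B] occurs,
    and the interval is the Boolean lattice of subsets of [B].  The bottom is
    [(0, 1)] because [Z^d] is torsion free; finiteness holds because [G_A] is
    generated by finitely many elements of finite order, on which characters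
    take values in roots of unity. *)
From HB Require Import structures.
Require Import Defs.
From Stdlib Require Import Relation_Definitions Relation_Operators.
From mathcomp Require Import all_boot all_order all_algebra.
From mathcomp Require Import boolp classical_sets cardinality reals complex.

Set Implicit Arguments.
Unset Strict Implicit.
Unset Printing Implicit Defensive.

Import Order.TTheory GRing.Theory Num.Theory.
Local Open Scope ring_scope.

(** * Integral rows and torsion classes of the quotients *)

Lemma rat_row_common_denom (d : nat) (u : 'rV[rat]_d) :
  exists k (v : 'rV[int]_d), k != 0 /\ k%:~R *: u = map_mx intr v.
Proof.
pose k := \prod_j denq (u 0 j).
exists k, (\row_j (numq (u 0 j) * \prod_(i | i != j) denq (u 0 i))).
split; first by apply/prodf_neq0 => j _; exact: denq_neq0.
apply/rowP => j; rewrite !mxE /k (bigD1 j) //= !intrM -[X in _ * X = _]divq_num_den.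
by rewrite mulrAC [_ * (_ / _)]mulrC divfK // intr_eq0 denq_neq0.
Qed.

Lemma additive_rV_int (d r : nat) (g : {additive 'rV[int]_d -> 'rV[int]_r}) v :
  g v = v *m (\matrix_j g (delta_mx 0 j)).
Proof.
rewrite {1}[v]row_sum_delta raddf_sum mulmx_sum_row; apply: eq_bigr => j _.
by rewrite rowK -[v 0 j]intz !scaler_int raddfMz.
Qed.

HB.instance Definition _ (V : zmodType) n (z : 'I_n -> V) (A : {set 'I_n}) :=
  GRing.isZmodMorphism.Build V (realized z A) (mk z A) (@mkB V n z A).

Lemma mk_eq0 (V : zmodType) n (z : 'I_n -> V) (A : {set 'I_n}) v :
  mk z A v = 0 <-> v \in gen_sub z A.
Proof. by rewrite -[0](raddf0 (mk z A)) mk_eq subr0. Qed.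

Lemma mk_torsionP (V : zmodType) n (z : 'I_n -> V) (A : {set 'I_n}) v :
  reflect (exists2 k : nat, (0 < k)%N & v *+ k \in gen_sub z A)
          (mk z A v \in @torsion (realized z A)).
Proof.
apply: (iffP (torsionP _)) => -[k k0 H]; exists k => //.
  by apply/mk_eq0; rewrite raddfMn.
by rewrite -raddfMn; apply/mk_eq0.
Qed.

(** * Free rank of the quotients and linear independence over the rationals *)

Section Lattice.
Variables (d n : nat) (z : 'I_n -> 'rV[int]_d).
Implicit Types (A B : {set 'I_n}) (b : 'I_n).

(** Zero rows outside [A] give the same shape for every [A], so subsets need no reindexing. *)
Definition gen_mx A : 'M[int]_(n, d) := \matrix_i (if i \in A then z i else 0).

Lemma gen_sub_mxP A v :
  reflect (exists c : 'rV_n, v = c *m gen_mx A) (v \in gen_sub z A).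
Proof.
have E (c : 'I_n -> int) :
    \sum_(i in A) z i *~ c i = (\row_i c i) *m gen_mx A.
  rewrite mulmx_sum_row big_mkcond; apply: eq_bigr => i _.
  rewrite rowK mxE; case: ifP => _; last by rewrite scaler0.
  by rewrite -scaler_int intz.
apply: (iffP (gen_subP _ _ _)) => [[c ->]|[c ->]].
  by rewrite E; eexists.
exists (c 0); rewrite E; congr (_ *m _); by apply/rowP => i; rewrite !mxE.
Qed.

(* [U] presents the quotient of [Z^d] by the saturation of the sublattice
   generated by the [z i], i in A, and [W] is a section of it. *)
Definition torsion_splitting A r (U : 'M[int]_(d, r)) (W : 'M[int]_(r, d)) :=
  W *m U = 1%:M /\
  forall v, v *m U = 0 <-> mk z A v \in @torsion (realized z A).

(** In the basis given by the rows of [T], the sublattice is spanned by multiples of some basis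
    vectors. A class is torsion iff its coordinates [v *m invmx T] vanish at all other vectors, so
    [U] reads off those coordinates and [W] consists of the corresponding rows of [T]. *)
Lemma torsion_splitting_exists A :
  exists r (U : 'M[int]_(d, r)) W, torsion_splitting A U W.
Proof.
have [L uL [T uT [s _ E]]] := int_Smith_normal_form (gen_mx A).
set D : 'M_(n, d) := (X in L *m X *m T) in E.
have DE (c : 'rV_n) (j : 'I_d) : (c *m D) 0 j =
    (if insub (j : nat) is Some i then c 0 i else 0) * s`_j.
  rewrite mxE; case: insubP => [i _ ij|nj].
    rewrite (bigD1 i) //= mxE ij eqxx mulr1n big1 ?addr0 // => k ki.
    by rewrite mxE -ij -(inj_eq val_inj) in ki *; rewrite (negPf ki) mulr0n mulr0.
  rewrite mul0r big1 // => k _; rewrite mxE.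
  by case: eqP => [kj|]; rewrite ?mulr0n ?mulr0 //; rewrite -kj ltn_ord in nj.
(* [P] selects the nonzero invariant factors; past the end of [s] the default 0 excludes [j]. [J]
   indexes the free directions. *)
pose P := [pred j : 'I_d | (j < n)%N && (s`_j != 0)].
pose J := [set j : 'I_d | ~~ P j].
exists #|J|, (colsub (@enum_val _ (mem J)) (invmx T)).
exists (rowsub (@enum_val _ (mem J)) T); split.
  rewrite mulmx_colsub mul_rowsub_mx mulmxV //; apply/matrixP => i j.
  by rewrite !mxE (inj_eq enum_val_inj).
move=> v; rewrite mulmx_colsub; split.
  move=> v0; pose w := v *m invmx T.
  have w0 j : ~~ P j -> w 0 j = 0.
    move=> Pj; have jJ : j \in J by rewrite inE.
    have /rowP/(_ (enum_rank_in jJ j)) := v0.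
    by rewrite !mxE enum_rankK_in //= => <-; rewrite mxE.
  (* The product of the nonzero invariant factors annihilates all torsion. *)
  pose K := \prod_(j | P j) s`_j.
  have K0 : K != 0 by apply/prodf_neq0 => j /andP[].
  apply/mk_torsionP; exists (absz K); first by rewrite absz_gt0.
  (* At [j] in [P], the factor from [D] completes the product to [K]; elsewhere both [c *m D] and
     [w] vanish. *)
  pose c : 'rV[int]_n := \row_i (if insub (i : nat) is Some j
     then w 0 j * \prod_(k | P k && (k != j)) s`_k else 0).
  have cD : c *m D = K *: w.
    apply/rowP => j; rewrite DE [RHS]mxE.
    have [Pj|nPj] := boolP (P j); last first.
      rewrite (w0 _ nPj) mulr0; move: nPj; rewrite negb_and negbK.
      case: insubP => [i ->|]; rewrite /= ?mul0r // => ij.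
      by move/eqP->; rewrite mulr0.
    have /andP[jn sj] := Pj.
    rewrite insubT /c [X in X * _]mxE SubK valK.
    have -> : K = s`_j * \prod_(k | P k && (k != j)) s`_k.
      by rewrite /K (bigD1 j).
    by rewrite mulrC [w 0 j * _]mulrC mulrA.
  have vK : v *~ K \in gen_sub z A.
    apply/gen_sub_mxP; exists (c *m invmx L).
    rewrite E !mulmxA mulmxKV // cD -scalemxAl mulmxKV //.
    by rewrite -scaler_int intz.
  case: (intP K) vK => [|m|m] //.
  by rewrite abszN mulrNz rpredN.
move=> /mk_torsionP[k k0 /gen_sub_mxP[c vk]].
apply/rowP => a; rewrite [in RHS]mxE mxE.
set j := enum_val a.
have : ~~ P j by have := enum_valP a; rewrite inE.
have : (v *m invmx T) *+ k = c *m L *m D.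
  by rewrite -[c *m L *m D](mulmxK uT) -scaler_nat scalemxAl scaler_nat vk E !mulmxA.
move/rowP/(_ j); rewrite DE => Ej Pj.
apply/eqP; have : (v *m invmx T) 0 j *+ k = 0.
  rewrite -mulmxnE Ej; move: Pj; rewrite negb_and negbK.
  by case: insubP => [i ->|]; rewrite /= ?mul0r // => ij /eqP->; rewrite mulr0.
by move/eqP; rewrite mulrn_eq0 -leqn0 leqNgt k0.
Qed.

(** From a decomposition, [U] is the matrix of its free component on [Z^d], and the rows of [W] lift
    the preimages of the unit vectors. Conversely, [v] splits into [v *m U] and the torsion class of
    [v - v *m U *m W]. *)
Lemma is_free_rankP A r :
  is_free_rank (realized z A) r <->
  exists (U : 'M[int]_(d, r)) W, torsion_splitting A U W.
Proof.
split=> [[f bij_f]|[U [W [WU UP]]]].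
  pose g v := (f (mk z A v)).1.
  have gB : zmod_morphism g by move=> u v; rewrite /g !raddfB.
  pose gM := GRing.isZmodMorphism.Build _ _ g gB.
  pose G : {additive _ -> _} := HB.pack g gM.
  have [h fh hf] := bij_f.
  have gE v : g v = v *m (\matrix_j g (delta_mx 0 j)).
    exact: (additive_rV_int G).
  pose W : 'M[int]_(r, d) := \matrix_i repr (h (delta_mx 0 i, 0)).
  exists (\matrix_j g (delta_mx 0 j)), W; split.
    apply/row_matrixP => i; rewrite row_mul -gE rowK /g.
    by rewrite /mk reprK hf /= rowE mulmx1.
  move=> v; rewrite -gE; split=> [g0|/torsionP[k k0 vk]].
    have /torsionP[k k0 tk] := torsion_valP (f (mk z A v)).2.
    apply/torsionP; exists k => //; apply: (can_inj fh).
    rewrite raddf0 raddfMn; case E : (f _) g0 tk => [a t]; rewrite /g E /= => -> tk.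
    have tk0 : t *+ k = 0 by apply: val_inj; rewrite raddfMn.
    by rewrite [LHS]surjective_pairing (raddfMn fst) (raddfMn snd) mul0rn tk0.
  have : g v *+ k = 0.
    by rewrite /g -[LHS](raddfMn fst) -raddfMn vk !raddf0.
  move=> gk; apply/rowP => j; apply/eqP; rewrite mxE.
  have /rowP/(_ j)/eqP := gk.
  by rewrite mulmxnE mxE mulrn_eq0 -leqn0 leqNgt k0.
have tP v : mk z A (v - v *m U *m W) \in @torsion (realized z A).
  by apply/UP; rewrite mulmxBl -[_ *m W *m U]mulmxA WU mulmx1 subrr.
have gU v : v \in gen_sub z A -> v *m U = 0.
  by move=> vA; apply/UP/mk_torsionP; exists 1%N.
(* Defined on a representative; [fE] shows independence of its choice. *)
pose f (x : realized z A) : 'rV[int]_r * torsion_group (realized z A) :=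
  (repr x *m U, TorsionGroup (tP (repr x))).
have fE v : f (mk z A v) = (v *m U, TorsionGroup (tP v)).
  have /mk_eq/gU : mk z A (repr (mk z A v)) = mk z A v by rewrite /mk reprK.
  rewrite mulmxBl => /eqP; rewrite subr_eq0 => /eqP E.
  rewrite /f; congr (_, _) => //; apply: val_inj => /=; rewrite E !raddfB /=.
  by rewrite /mk reprK.
have fB : zmod_morphism f.
  move=> x y; have [u ->] := mk_surj x; have [v ->] := mk_surj y.
  rewrite -raddfB !fE; congr (_, _); first exact: mulmxBl.
  apply: val_inj; rewrite /= -raddfB; congr (mk z A _).
  by rewrite !mulmxBl [in LHS]opprD addrACA -opprD.
pose fM := GRing.isZmodMorphism.Build _ _ f fB.
pose F : {additive _ -> _} := HB.pack f fM.
exists F; exists (fun p => mk z A (p.1 *m W) + torsion_val p.2).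
  move=> x; have [v ->] := mk_surj x; rewrite [F _]fE.
  by rewrite -raddfD addrC subrK.
case=> w [t tT]; have [v tv] := mk_surj t; move: tT; rewrite {t}tv => tT.
have vU : v *m U = 0 by apply/UP.
transitivity (f (mk z A (w *m W + v))); first by rewrite [in RHS]raddfD.
rewrite fE.
congr (_, _); first by rewrite mulmxDl -mulmxA WU mulmx1 vU addr0.
apply: val_inj => /=; congr (mk z A _).
by rewrite !mulmxDl -[_ *m W *m U]mulmxA WU mulmx1 vU mul0mx addr0 addrAC subrr add0r.
Qed.

Definition gen_rank A : nat := \rank (map_mx intr (gen_mx A) : 'M[rat]_(n, d)).

(** Over the rationals the kernel of [U] is the span of the generators: a kernel vector, cleared of
    denominators, has a torsion class, so a multiple of it lies in the sublattice. In particular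
    [free_rank] does not depend on the choice made by [xget]. *)
Lemma torsion_splitting_rank A r (U : 'M[int]_(d, r)) W :
  torsion_splitting A U W -> gen_rank A = (d - r)%N.
Proof.
case=> WU UP; pose q m k (X : 'M[int]_(m, k)) : 'M[rat]_(m, k) := map_mx intr X.
have rU : \rank (q _ _ U) = r.
  apply/eqP; rewrite eqn_leq rank_leq_col /=.
  have := mxrankM_maxr (q _ _ W) (q _ _ U).
  by rewrite /q -map_mxM WU map_mx1 mxrank1.
rewrite -{1}rU -mxrank_ker; apply/eqP; rewrite eqn_leq; apply/andP; split.
  apply/mxrankS/sub_kermxP; rewrite -map_mxM -[RHS](map_mx0 intr); congr map_mx.
  apply/row_matrixP => i; rewrite row_mul row0; apply/UP/mk_torsionP.
  exists 1%N => //; apply/gen_sub_mxP; exists (delta_mx 0 i); exact: rowE.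
apply/mxrankS/row_subP => i.
have : row i (kermx (q _ _ U)) *m q _ _ U = 0 by rewrite -row_mul mulmx_ker row0.
set u := row i _ => uU; have [k [v [k0 kv]]] := rat_row_common_denom u.
have /UP/mk_torsionP[m m0 /gen_sub_mxP[c vm]] : v *m U = 0.
  have : map_mx intr (v *m U) = 0 :> 'M[rat]__.
    by rewrite map_mxM -kv -scalemxAl uU scaler0.
  move=> /matrixP vU; apply/matrixP => a b; rewrite [RHS]mxE; apply/eqP.
  by have /eqP := vU a b; rewrite [eqbLHS]mxE [eqbRHS]mxE intr_eq0.
have km : (m%:R * k%:~R : rat) != 0.
  by rewrite mulf_neq0 ?intr_eq0 // pnatr_eq0 -lt0n.
rewrite -(eqmx_scale _ km) -scalerA kv scaler_nat.
have -> : map_mx intr v *+ m = map_mx intr (v *+ m) :> 'M[rat]_(1, d).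
  by apply/rowP => j; rewrite mulmxnE !mxE mulmxnE rmorphMn.
by rewrite vm map_mxM submxMl.
Qed.

Lemma rank_gen_rank A : (gen_rank A + rank z A = d)%N.
Proof.
have : is_free_rank (realized z A) (rank z A).
  apply: xgetPex; have [r UW] := torsion_splitting_exists A.
  by exists r; apply/is_free_rankP.
move=> /is_free_rankP[U [W UW]]; rewrite (torsion_splitting_rank UW) subnK //.
(* [W *m U = 1%:M] bounds the free rank by [d], so the truncated subtraction is exact. *)
have [WU _] := UW.
have := mxrankM_maxr (map_mx intr W : 'M[rat]_(_, d)) (map_mx intr U).
by rewrite -map_mxM WU map_mx1 mxrank1 => /leq_trans-> //; rewrite rank_leq_row.
Qed.

Lemma gen_rank0 : gen_rank finset.set0 = 0%N.
Proof.
apply/eqP; rewrite mxrank_eq0; apply/eqP/row_matrixP => i.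
by rewrite -map_row rowK inE map_mx0 row0.
Qed.

Lemma gen_rankU1 A b : (gen_rank (b |: A) <= (gen_rank A).+1)%N.
Proof.
pose S : 'M[rat]_d := (map_mx intr (z b) + map_mx intr (gen_mx A))%MS.
apply: leq_trans (_ : \rank S <= _)%N.
  apply/mxrankS/row_subP => i; rewrite -map_row rowK in_setU1.
  have [->|_] /= := eqVneq i b; first exact: addsmxSl.
  apply: submx_trans (addsmxSr _ _).
  by have := row_sub i (map_mx intr (gen_mx A) : 'M[rat]_(n, d)); rewrite -map_row rowK.
apply: leq_trans (mxrank_adds_leqif _ _) _.
by rewrite -[(gen_rank A).+1]add1n leq_add2r rank_leq_row.
Qed.

Lemma gen_rank_card A : (gen_rank A <= #|A|)%N.
Proof.
move: {2}#|A| (erefl #|A|) => m; elim: m A => [|m IH] A.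
  by move/eqP; rewrite cards_eq0 => /eqP->; rewrite gen_rank0.
move=> Am; have /card_gt0P[b bA] : (0 < #|A|)%N by rewrite Am.
have := cardsD1 b A; rewrite bA Am add1n => -[mE].
have := gen_rankU1 (A :\ b) b; rewrite finset.setD1K // => /leq_trans-> //.
by rewrite mE ltnS IH.
Qed.

Lemma independentP A :
  (rank z finset.set0)%:Z - (rank z A)%:Z = #|A|%:Z <-> gen_rank A = #|A|.
Proof.
have := rank_gen_rank finset.set0; rewrite gen_rank0 add0n => ->.
rewrite -{1}(rank_gen_rank A) PoszD addrK; split=> [[]|->] //.
Qed.

(** One new vector raises the rank by at most one, so a rank deficit of [A] would persist in
    [b |: A]. *)
Lemma independentD1 A b : b \notin A ->
  gen_rank (b |: A) = #|b |: A| -> gen_rank A = #|A|.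
Proof.
move=> bA; rewrite cardsU1 bA add1n => E; apply/eqP.
by rewrite eqn_leq gen_rank_card -ltnS -E gen_rankU1.
Qed.

End Lattice.

(** * Characters and finiteness of the dual group *)

Lemma finite_unity_roots (F : closedFieldType) k : (0 < k)%N ->
  exists s : seq F, forall x, x ^+ k = 1 -> x \in s.
Proof.
move=> k0; have [s sE] := closed_field_poly_normal ('X^k - 1 : {poly F}).
exists s => x xk.
have : root ('X^k - 1) x by rewrite rootE !hornerE xk subrr.
rewrite sE (monicP _) ?scale1r ?root_prod_XsubC //.
exact: monic_Xn_sub_1.
Qed.

Section Characters.
Variables (R : realType) (G : zmodType).

Lemma dual_ext (h l : dual_group R G) : h =1 l -> h = l.
Proof.
case: h => h h0 hD; case: l => l l0 lD /= /funext hl.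
by subst l; congr DualGroup; exact: Prop_irrelevance.
Qed.

Lemma dual0 (h : dual_group R G) : h 0 = 1.
Proof. by apply: (mulfI (dual_neq0 h 0)); rewrite -dualD addr0 mulr1. Qed.

Lemma dualMn (h : dual_group R G) x k : h (x *+ k) = h x ^+ k.
Proof.
by elim: k => [|k IH]; rewrite ?mulr0n ?dual0 // mulrS dualD IH exprS.
Qed.

Lemma dual_sum (h : dual_group R G) (I : Type) (r : seq I) (F : I -> G) :
  h (\sum_(i <- r) F i) = \prod_(i <- r) h (F i).
Proof. exact: (big_morph h (dualD h) (dual0 h)). Qed.

Lemma dualN (h : dual_group R G) x : h (- x) = (h x)^-1.
Proof.
by apply: (mulfI (dual_neq0 h x)); rewrite -dualD subrr dual0 divff ?dual_neq0.
Qed.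

Lemma dual_eqMz (h l : dual_group R G) x (c : int) :
  h x = l x -> h (x *~ c) = l (x *~ c).
Proof.
by move=> hl; case: c => k; rewrite ?NegzE ?mulrNz -?pmulrn ?dualN !dualMn hl.
Qed.

(** A character is determined by its values on the generators, which are roots of unity; it is
    encoded by the positions of these values in finite lists. *)
Lemma dual_finite d (g : 'I_d -> G) :
  (forall j, exists2 k : nat, (0 < k)%N & g j *+ k = 0) ->
  (forall x, exists c : 'I_d -> int, x = \sum_j g j *~ c j) ->
  finite_set [set: dual_group R G].
Proof.
move=> tors_g gen_g.
have /choice[s sP] j : exists s : seq R[i],
    forall h : dual_group R G, h (g j) \in s.
  have [k k0 gk] := tors_g j; have [s sP] := finite_unity_roots R[i] k0.
  by exists s => h; apply: sP; rewrite -dualMn gk dual0.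
pose m := \max_j size (s j).
pose f (h : dual_group R G) : {ffun 'I_d -> 'I_m.+1} :=
  [ffun j => inord (index (h (g j)) (s j))].
have -> : [set: dual_group R G]%classic = (f @^-1` setT)%classic by [].
apply: finite_preimage; last exact: finite_finset.
move=> h l _ _ /ffunP fhl; apply: dual_ext => x; have [c ->] := gen_g x.
rewrite !dual_sum; apply: eq_bigr => j _; apply: dual_eqMz.
have lt (u : dual_group R G) : (index (u (g j)) (s j) < m.+1)%N.
  rewrite ltnS (leq_trans (index_size _ _)) //.
  exact: (leq_bigmax (F := fun j => size (s j))).
have /(congr1 val) := fhl j; rewrite !ffunE /= !inordK // => E.
by rewrite -(nth_index 0 (sP j h)) E nth_index.
Qed.

End Characters.

(** * The order on the torsions and its intervals *)

Section Poset.
Variables (R : realType) (d n : nat) (z : 'I_n -> 'rV[int]_d).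
Implicit Types (A B C : {set 'I_n}) (b : 'I_n) (p q : Gr z R).

(** [1 - U *m W] projects [Z^d] onto the kernel of [U], so the classes of its rows generate the
    torsion. *)
Lemma tors_gen A : exists g : 'I_d -> tors z A,
  (forall j, exists2 k : nat, (0 < k)%N & g j *+ k = 0) /\
  (forall x, exists c : 'I_d -> int, x = \sum_j g j *~ c j).
Proof.
have [r [U [W [WU UP]]]] := torsion_splitting_exists z A.
pose P : 'M[int]_d := 1%:M - U *m W.
have PU : P *m U = 0 by rewrite mulmxBl mul1mx -mulmxA WU mulmx1 subrr.
have tP j : mk z A (row j P) \in @torsion (realized z A).
  by apply/UP; rewrite -row_mul PU row0.
exists (fun j => TorsionGroup (tP j)); split=> [j|[t tT]].
  have /torsionP[k k0 tk] := tP j; exists k => //.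
  by apply: val_inj; rewrite raddfMn.
have [v tv] := mk_surj t; move: tT; rewrite {t}tv => tT.
exists (v 0); apply: val_inj; rewrite raddf_sum.
have /UP vU := tT.
transitivity (mk z A (v *m P)).
  by rewrite mulmxBr mulmx1 mulmxA vU mul0mx subr0.
rewrite mulmx_sum_row raddf_sum; apply: eq_bigr => j _.
by rewrite raddfMz -{1}[v 0 j]intz scaler_int raddfMz.
Qed.

Lemma Gr_finite : finite_set [set: Gr z R].
Proof.
have -> : [set: Gr z R]%classic = (\bigcup_(A in [set: {set 'I_n}])
    [set p : Gr z R | gr_set p = A])%classic.
  by apply/seteqP; split=> // p _; exists (gr_set p).
apply: bigcup_finite => [|A _]; first exact: finite_finset.
(* The fibre over [A] is an image of the dual group if [A] is independent, and empty otherwise. *)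
have [iA|niA] := pselect ((rank z finset.set0)%:Z - (rank z A)%:Z = #|A|%:Z).
  have [g [g1 g2]] := tors_gen A.
  have := finite_image (fun h : dual z R A => MkGr h iA) (dual_finite R g1 g2).
  apply: sub_finite_set => -[A' h iA'] /= E; subst A'.
  by exists h => //; congr MkGr; exact: Prop_irrelevance.
by apply: sub_finite_set (finite_set0 _) => -[A' h iA'] /= E; subst A'.
Qed.

(** For [A] contained in [B] this is the graph of the map from [G_A] to [G_B]; as a relation it
    avoids composing one-step projections between dependent types. *)
Definition same_class A B (x : tors z A) (y : tors z B) :=
  exists v, torsion_val x = mk z A v /\ torsion_val y = mk z B v.

Definition char_le p q :=
  gr_set p \subset gr_set q /\
  forall x y, @same_class (gr_set p) (gr_set q) x y -> gr_char p x = gr_char q y.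

Lemma mk_torsionS A B v : A \subset B ->
  mk z A v \in @torsion (realized z A) -> mk z B v \in @torsion (realized z B).
Proof.
move=> sAB /mk_torsionP[k k0 vk]; apply/mk_torsionP; exists k => //.
exact: gen_subS vk.
Qed.

Lemma same_class_push A B v (x : tors z A) : A \subset B ->
  torsion_val x = mk z A v -> exists y : tors z B, torsion_val y = mk z B v.
Proof.
move=> sAB xv; have := torsion_valP x; rewrite xv => /(mk_torsionS sAB) vB.
by exists (TorsionGroup vB).
Qed.

Lemma same_class_eq A (x y : tors z A) : same_class x y -> x = y.
Proof. by case=> v [xv yv]; apply: val_inj; rewrite /= xv yv. Qed.

Lemma char_le_refl p : char_le p p.
Proof. by split=> // x y /same_class_eq->. Qed.

Lemma char_le_trans q p r : char_le p q -> char_le q r -> char_le p r.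
Proof.
move=> [spq pq] [sqr qr]; split; first exact: fintype.subset_trans sqr.
move=> x y [v [xv yv]]; have [t tv] := same_class_push spq xv.
by rewrite (pq x t) ?(qr t y) //; exists v.
Qed.

Lemma char_le_anti p q : char_le p q -> gr_set p = gr_set q -> p = q.
Proof.
case: p q => [A h iA] [B l iB] [/= _ hl] E; subst B.
have -> : h = l.
  apply: dual_ext => x; apply: hl; have [v xv] := mk_surj (torsion_val x).
  by exists v.
by congr MkGr; exact: Prop_irrelevance.
Qed.

(** Both characters are restrictions of that of [q], so they are compared by pushing the common
    class forward to [q]. *)
Lemma char_le_below q p r : char_le p q -> char_le r q ->
  gr_set p \subset gr_set r -> char_le p r.
Proof.
move=> [spq pq] [srq rq] spr; split=> // x y [v [xv yv]].
have [t tv] := same_class_push spq xv.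
by rewrite (pq x t) ?(rq y t) //; exists v.
Qed.

Lemma Gr_covers_char_le p q : Gr_covers z R q p -> char_le p q.
Proof.
case=> A [b [h [hA [l [lA [bA -> -> <-]]]]]].
split=> /=; first exact: finset.subsetUr.
move=> x y [v [xv yv]]; congr (h _); apply: val_inj.
by rewrite /= xv proj_mk yv.
Qed.

Lemma Gr_le_char_le p q : Gr_le z R p q -> char_le p q.
Proof.
elim=> [x y /Gr_covers_char_le //|x|x y t _ xy _ yt]; first exact: char_le_refl.
exact: char_le_trans xy yt.
Qed.

Lemma Gr_covers_remove q b : b \in gr_set q ->
  exists2 p, Gr_covers z R q p & gr_set p = gr_set q :\ b.
Proof.
case: q => B l iB /= bB.
have bA : b \notin B :\ b by rewrite !inE eqxx.
(* Rewriting [B] as [b |: A] gives [l] the type that [dual_proj] expects. *)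
have BE := finset.setD1K bB; move: (B :\ b) bA BE => A bA BE; subst B.
have /independentP/(independentD1 bA)/independentP iA := iB.
exists (MkGr (dual_proj l) iA) => //.
by exists A, b, l, iB, (dual_proj l), iA.
Qed.

(** Elements outside [C] are removed one at a time, each removal being a cover. *)
Lemma Gr_le_restrict q C : C \subset gr_set q ->
  exists2 p, Gr_le z R p q & gr_set p = C.
Proof.
move: {2}#|gr_set q| (leqnn #|gr_set q|) => m.
elim: m q => [|m IH] q qm sC.
  exists q; first exact: rt_refl.
  move: qm; rewrite leqn0 cards_eq0 => /eqP q0.
  by move: sC; rewrite q0 finset.subset0 => /eqP->.
have [->|nqC] := eqVneq C (gr_set q); first by exists q => //; exact: rt_refl.
have /properP[_ [b bq bC]] : C \proper gr_set q by rewrite finset.properEneq nqC.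
have [r qr rE] := Gr_covers_remove bq.
have [||p pr pC] := IH r.
- by rewrite rE -ltnS (leq_trans _ qm) // [X in (_ < X)%N](cardsD1 b) bq.
- by rewrite rE finset.subsetD1 sC.
by exists p => //; apply: rt_trans pr _; exact: rt_step.
Qed.

(** Conversely, restricting [q] along covers to the set of [p] yields an element with the same set,
    also below [q], hence [p] itself. *)
Lemma Gr_leP p q : Gr_le z R p q <-> char_le p q.
Proof.
split=> [|pq]; first exact: Gr_le_char_le.
have [r rq rp] := Gr_le_restrict pq.1.
suff -> : p = r by [].
apply: char_le_anti => //; apply: char_le_below pq (Gr_le_char_le rq) _.
by rewrite rp.
Qed.

Lemma Gr_le_order : Relation_Definitions.order (Gr z R) (Gr_le z R).
Proof.
split; [exact: rt_refl|exact: rt_trans|].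
move=> p q /Gr_leP pq /Gr_leP qp; apply: char_le_anti => //.
by apply/eqP; rewrite finset.eqEsubset pq.1 qp.1.
Qed.

Definition bot_char : dual z R finset.set0 :=
  @DualGroup R (tors z finset.set0) (fun=> 1) (fun=> oner_neq0 _)
    (fun _ _ => esym (mulr1 1)).

Definition Gr_bot : Gr z R.
Proof.
by refine (@MkGr _ _ _ _ finset.set0 bot_char _); rewrite subrr cards0.
Defined.

(** This is where freeness of [M(0)] enters: the sublattice generated by no vector is zero, and
    [Z^d] has no torsion. *)
Lemma tors0_eq0 (v : 'rV[int]_d) :
  mk z finset.set0 v \in @torsion (realized z finset.set0) -> v = 0.
Proof.
move=> /mk_torsionP[k k0 /gen_subP[c]]; rewrite big_set0 => vk.
apply/rowP => j; apply/eqP; have /rowP/(_ j)/eqP := vk.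
by rewrite mulmxnE (mxE _ (fun _ _ => 0)) mulrn_eq0 -leqn0 leqNgt k0.
Qed.

Lemma Gr_bot_le p : Gr_le z R Gr_bot p.
Proof.
apply/Gr_leP; split=> [|x y [v [xv yv]]]; first exact: finset.sub0set.
have := torsion_valP x; rewrite xv => /tors0_eq0 v0.
have -> : y = 0 by apply: val_inj; rewrite /= yv v0 raddf0.
by rewrite dual0.
Qed.

Lemma Gr_bot_unique_minimal : unique (minimal (Gr_le z R)) Gr_bot.
Proof.
have [_ _ anti] := Gr_le_order.
split=> [p pb|p /(_ _ (Gr_bot_le p))] //; exact: anti pb (Gr_bot_le p).
Qed.

Lemma Gr_boolean_interval q : boolean_interval (Gr_le z R) Gr_bot q.
Proof.
pose f (x : closed_interval (Gr_le z R) Gr_bot q) : {set 'I_#|gr_set q|} :=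
  [set i | enum_val i \in gr_set (sval x)].
have below (x : closed_interval (Gr_le z R) Gr_bot q) : char_le (sval x) q.
  by case: x => x /= [_ /Gr_leP].
have fP x y : Gr_le z R (sval x) (sval y) <-> f x \subset f y.
  rewrite Gr_leP; split=> [[/fintype.subsetP sxy _]|/fintype.subsetP fxy].
    by apply/fintype.subsetP => i; rewrite !inE; exact: sxy.
  apply: char_le_below (below x) (below y) _; apply/fintype.subsetP => a ax.
  have aq : a \in gr_set q by apply: fintype.subsetP ax; exact: (below x).1.
  have := fxy (enum_rank_in aq a); rewrite !inE enum_rankK_in //; exact.
(* Surjectivity: every subset of the set of [q] is reached by a restriction of [q]. *)
have /choice[g fg] (C : {set 'I_#|gr_set q|}) : exists x, f x = C.
  have [|p pq pC] := @Gr_le_restrict q [set enum_val i | i in C].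
    by apply/fintype.subsetP => _ /imsetP[i _ ->]; exact: enum_valP.
  exists (exist _ p (conj (Gr_bot_le p) pq)); apply/setP => i.
  by rewrite inE /= pC mem_imset //; exact: enum_val_inj.
exists #|gr_set q|, f; split=> //; exists g => // x.
have [_ _ anti] := Gr_le_order.
(* Injectivity: equal images give inequalities both ways by [fP]. *)
have : sval (g (f x)) = sval x by apply: anti; apply/fP; rewrite fg.
case: (g (f x)) => p Hp; case: x => p' Hp' /= E; subst p'.
by congr exist; exact: Prop_irrelevance.
Qed.

End Poset.

Theorem theorem3p3 (R : realType) (d n : nat) (z : 'I_n -> 'rV[int]_d) :
  simplicial_poset (Gr_le z R).
Proof.
split; [exact: Gr_finite|exact: Gr_le_order|].
exists (Gr_bot R z); split; first exact: Gr_bot_unique_minimal.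
exact: Gr_boolean_interval.
Qed.
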